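(* Let $a\in\mathbb{N}^n$ and $b\in\mathbb{N}^m$ with $a$ nonincreasing and $\sum_{i\le n} a_i=\sum_{i\le m} b_i$. For $k\in\{1,\dots,n\}$ let $(\mathrm{GR}_k)$ denote the inequality $$\sum_{i\le k} a_i\le\sum_{i\le k} b'_i .$$ The following are equivalent: (1) $(a,b)$ is bigraphic; (2) $a\trianglelefteq b'$; (3) $(\mathrm{GR}_k)$ holds for all $k\in\{1,\dots,n\}$; (4) $(\mathrm{GR}_k)$ holds for all $k\in C(a)$ such that $k<\max_i b_i$; (5) $j\,a'_j+\sum_{i>j}a'_i\le\sum_{i\le a'_j} b'_i$ for all $j\in C(a')$ such that $a'_j<\max_i b_i$.
   Context: $\mathbb{N}=\{0,1,2,\dots\}$. The pair $(a,b)$ is bigraphic if there is a (simple, i.e. no multiple edges) bipartite graph on $n+m$ vertices, with parts of sizes $n$ and $m$, whose degree sequence is $a$ on the first part and $b$ on the second part. For $c\in\mathbb{N}^p$, the conjugate $c'=(c'_1,c'_2,\dots)$ is defined by $c'_k=\#\{i: c_i\ge k\}$ for $k\ge1$ (so $c'_k=0$ for all large $k$). For nonnegative integer sequences $x,y$ (finite ones extended by zeros), $x\trianglelefteq y$ means $\sum_{i\le k}x_i\le\sum_{i\le k}y_i$ for all $k\ge1$. For a nonincreasing $x\in\mathbb{N}^p$, the set of corners is $C(x)=\{k: 1\le k\le p,\ x_k>x_{k+1}\}$ with the convention $x_{p+1}=0$; likewise $C(a')=\{j\ge1: a'_j>a'_{j+1}\}$. *)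

(* Defs.v *)
From mathcomp Require Import all_boot.

Set Implicit Arguments.
Unset Strict Implicit.
Unset Printing Implicit Defensive.

(* A simple graph with vertex set 'I_n + 'I_m, given by its adjacency relation,
   that is bipartite with parts 'I_n and 'I_m. *)
Definition simple_bipartite n m (e : rel ('I_n + 'I_m)) : Prop :=
  [/\ symmetric e, irreflexive e,
      forall i i' : 'I_n, ~~ e (inl i) (inl i')
    & forall j j' : 'I_m, ~~ e (inr j) (inr j')].

Definition degree (V : finType) (e : rel V) (v : V) : nat := #|[set w | e v w]|.

Definition bigraphic n m (a : n.-tuple nat) (b : m.-tuple nat) : Prop :=
  exists e : rel ('I_n + 'I_m),
    [/\ simple_bipartite e,
        forall i : 'I_n, degree e (inl i) = tnth a i
      & forall j : 'I_m, degree e (inr j) = tnth b j].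

(* Infinite sequences x_1, x_2, ... are functions nat -> nat whose value at 0
   is never used: all index ranges below start at 1.  [ext0 c] is the finite
   sequence c, indexed from 1 and extended by zeros. *)
Definition ext0 (c : seq nat) (k : nat) : nat := nth 0 c k.-1.

Definition conjugate (c : seq nat) (k : nat) : nat := count (leq k) c.

Definition psum (x : nat -> nat) (k : nat) : nat := \sum_(1 <= i < k.+1) x i.

Definition dominated (x y : nat -> nat) : Prop :=
  forall k, 1 <= k -> psum x k <= psum y k.

Definition maxterm (c : seq nat) : nat := \max_(x <- c) x.

(* The sum of c'_i over all i > j; the terms with i > maxterm c vanish. *)
Definition conjugate_tail (c : seq nat) (j : nat) : nat :=
  \sum_(j.+1 <= i < (maxterm c).+1) conjugate c i.

Definition corner (x : nat -> nat) (k : nat) : bool :=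
  (1 <= k) && (x k.+1 < x k).

Definition corner_seq (c : seq nat) (k : nat) : bool :=
  (k <= size c) && corner (ext0 c) k.

Definition GR (a b : seq nat) (k : nat) : bool :=
  psum (ext0 a) k <= psum (conjugate b) k.

(* Main.v *)
Require Import Defs.
From mathcomp Require Import all_boot.
From mathcomp Require Import perm zify.

(* (1) => (2): in the 0/1 biadjacency matrix, the column of [b_j] contributes at
   most [min b_j k] to the first k rows, and the sum of these minima is
   [b'_1 + ... + b'_k].
   (4) => (2): at the smallest index k minimising [sum_(i <= k) (b'_i - a_i)],
   a negative minimum forces [a_k > b'_k >= b'_(k+1) >= a_(k+1)], a corner.
   (4) <=> (5): [k = a'_j] matches the corners j of a' with the corners k of a,
   and the left-hand side of (5) sums the entries of a that are at least j.
   (2) => (1) (after Krause): start from the matrix whose columns are packed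
   into the top rows, so that the row sums are b'.  If some row sum is too
   small, let j be the first such row; dominance gives a row i < j whose sum is
   too large, and monotonicity of a gives a column with a 1 in row i and a 0 in
   row j.  Swapping those two entries preserves dominance and lowers the total
   deficit. *)

(** * Conjugates, their partial sums and their corners *)

Lemma sum_leq_nat p q x : \sum_(p <= i < q) (i <= x : nat) = minn x.+1 q - p.
Proof.
elim: q => [|q IH]; first by rewrite big_geq //; lia.
have [pq|qp] := leqP p q; last by rewrite big_geq //; lia.
by rewrite big_nat_recr //= IH; case: (leqP q x); lia.
Qed.

Lemma conjugateE c k : conjugate c k = \sum_(x <- c) (k <= x : nat).
Proof. by rewrite /conjugate -sum1_count big_mkcond; apply: eq_bigr => x _; case: leqP. Qed.

(** Double counting: an entry [x] is counted in c'_i exactly when i <= x, hence [minn x k] times in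
    the first [k] terms. *)
Lemma psum_conjugate c k : psum (conjugate c) k = \sum_(x <- c) minn x k.
Proof.
rewrite /psum (eq_bigr _ (fun i _ => conjugateE c i)) exchange_big /=.
by apply: eq_bigr => x _; rewrite sum_leq_nat; lia.
Qed.

Lemma conjugate_tailE c j : conjugate_tail c j = \sum_(x <- c) (x - j).
Proof.
rewrite /conjugate_tail (eq_bigr _ (fun i _ => conjugateE c i)) exchange_big /=.
rewrite !big_seq; apply: eq_bigr => x xc; rewrite sum_leq_nat.
have : x <= maxterm c by apply: leq_bigmax_seq.
lia.
Qed.

Lemma leq_conjugate c i j : i <= j -> conjugate c j <= conjugate c i.
Proof. by move=> ij; apply: sub_count => x /=; apply: leq_trans. Qed.

Lemma psumS x k : psum x k.+1 = psum x k + x k.+1.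
Proof. by rewrite /psum big_nat_recr. Qed.

Lemma psum_ext0 n (c : n.-tuple nat) k :
  psum (ext0 c) k = \sum_(i < n | i < k) tnth c i.
Proof.
rewrite /psum big_add1 /= /ext0 /=.
under [RHS]eq_bigr => i _ do rewrite (tnth_nth 0).
have [kn|nk] := leqP k n; first by rewrite big_mkord (big_ord_widen _ (nth 0 c) kn).
rewrite (@big_cat_nat _ _ _ n) ?(ltnW nk) //= [X in _ + X = _]big_nat_cond.
rewrite [X in _ + X = _]big1 ?addn0.
  by rewrite big_mkord; apply: eq_bigl => i; rewrite (ltn_trans (ltn_ord i) nk).
by move=> i; rewrite andbT => /andP[ni _]; rewrite nth_default // size_tuple.
Qed.

(** In a nonincreasing sequence the entries that are at least [j] form a prefix, of length c'_j.
    Positivity of [j] rules out the default 0 read past the end. *)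
Lemma leq_nth_conjugate c i j :
  sorted geq c -> 0 < j -> (j <= nth 0 c i) = (i < conjugate c j).
Proof.
move=> + j0; elim: c i => [|x s IH] i c_noninc; first by rewrite nth_nil /conjugate /=; lia.
have/allP le_x : all (geq x) s by apply: order_path_min c_noninc; exact: rev_trans leq_trans.
have {}IH l := IH l (path_sorted c_noninc).
rewrite /conjugate /= -/(conjugate s j); have [jx|xj] := leqP j x.
  by case: i => [|i] /=; rewrite ?IH.
have -> : conjugate s j = 0.
  by apply/eqP; rewrite -leqn0 leqNgt -has_count; apply/hasPn => y /le_x /=; lia.
case: i => [|i] /=; first by lia.
have [si|si] := leqP (size s) i; first by rewrite nth_default //; lia.
by have /= := le_x _ (mem_nth 0 si); lia.
Qed.

(** The first c'_j entries are those with x >= j; each splits as j + (x - j), and smaller entries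
    add 0 to the tail. *)
Lemma psum_at_conjugate n (c : n.-tuple nat) j : sorted geq c -> 0 < j ->
  j * conjugate c j + conjugate_tail c j = psum (ext0 c) (conjugate c j).
Proof.
move=> c_noninc j0; rewrite conjugate_tailE conjugateE big_distrr -big_split /=.
rewrite -conjugateE psum_ext0 big_tuple [RHS]big_mkcond; apply: eq_bigr => i _.
by rewrite -leq_nth_conjugate // -tnth_nth; case: leqP; lia.
Qed.

(** With k = c'_j, the prefix property gives c_k >= j > c_(k+1). *)
Lemma corner_conjugate_seq c j : sorted geq c ->
  corner (conjugate c) j -> corner_seq c (conjugate c j).
Proof.
move=> c_noninc /andP[j0 lt_j]; have k0 : 0 < conjugate c j by lia.
rewrite /corner_seq /corner k0 count_size /ext0 /=.
have := leq_nth_conjugate _ (conjugate c j) j c_noninc j0.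
have := leq_nth_conjugate _ (conjugate c j).-1 j c_noninc j0.
lia.
Qed.

(** From c_(k+1) < j <= c_k follows c'_j = k, and c_k < j + 1 gives c'_(j+1) < k. *)
Lemma corner_seq_conjugate c k (j := ext0 c k) : sorted geq c ->
  corner_seq c k -> corner (conjugate c) j /\ conjugate c j = k.
Proof.
move=> c_noninc /and3P[_ k0]; rewrite -/j => lt_k; have j0 : 0 < j by lia.
have := leq_nth_conjugate _ k j c_noninc j0.
have := leq_nth_conjugate _ k.-1 j c_noninc j0.
have := leq_nth_conjugate _ k.-1 j.+1 c_noninc isT.
move: lt_k; rewrite /corner j0 /= /ext0 /= -[nth 0 c k.-1]/j => *; split; lia.
Qed.

(** * Reduction of the inequalities to the corners *)

Lemma GR_of_corners n m (a : n.-tuple nat) (b : m.-tuple nat) :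
  \sum_(i < n) tnth a i = \sum_(i < m) tnth b i ->
  (forall k, corner_seq a k -> k < maxterm b -> GR a b k) ->
  forall k, GR a b k.
Proof.
move=> sum_ab GR_corner.
pose S := \sum_(i < m) tnth b i.
have leb k : psum (conjugate b) k <= S.
  by rewrite psum_conjugate big_tuple; apply: leq_sum => i _; exact: geq_minl.
have lea k : psum (ext0 a) k <= S.
  by rewrite psum_ext0 /S -sum_ab [leqRHS](bigID (fun i : 'I_n => i < k)) leq_addr.
(* From [maxterm b] on, every minimum is the entry of [b] itself, so the right-hand side is the
   whole sum [S]. *)
have GR_max k : maxterm b <= k -> GR a b k.
  move=> bk; rewrite /GR psum_conjugate big_tuple (leq_trans (lea k)) //.
  apply: leq_sum => i _; rewrite leq_min leqnn (leq_trans _ bk) //.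
  by apply: leq_bigmax_seq; rewrite ?mem_tnth.
pose E k := psum (ext0 a) k + (S - psum (conjugate b) k).
(* [S - E k] is the slack of GR at k; find the first k where E is maximal. *)
have exE : exists v, [exists k : 'I_(maxterm b).+1, E k == v].
  by exists (E 0); apply/existsP; exists ord0.
have bndE v : [exists k : 'I_(maxterm b).+1, E k == v] -> v <= S + S.
  by move=> /existsP[k /eqP <-]; rewrite /E; have := lea k; lia.
case: (ex_maxnP exE bndE) => v /existsP[k0 /eqP Ek0] maxE.
have exk : exists k, (k <= maxterm b) && (E k == v).
  by exists (nat_of_ord k0); rewrite Ek0 eqxx -ltnS ltn_ord.
case: (ex_minnP exk) => k /andP[kb /eqP Ek] mink.
have leE l : l <= maxterm b -> E l <= E k.
  by move=> lb; rewrite Ek; apply: maxE; apply/existsP; exists (Ordinal (lb : l < _.+1)).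
have GRE l : GR a b l = (E l <= S) by rewrite /GR /E; have := leb l; lia.
(* GR at the maximiser bounds [E] by [S] on the whole range searched; [GR_max] covers the rest. *)
suff GRk : GR a b k.
  move=> l; have [/GR_max //|lb] := leqP (maxterm b) l.
  by rewrite GRE (leq_trans (leE l (ltnW lb))) // -GRE.
have [/GR_max //|{}kb] := leqP (maxterm b) k.
case: k => [|k] in Ek mink leE kb *; first by rewrite /GR /psum big_geq.
apply: GR_corner => //.
have ltE : E k < E k.+1.
  rewrite ltn_neqAle leE 1?ltnW ?andbT 1?ltnW //; apply/eqP => Ekk.
  by have := mink k; rewrite Ekk Ek eqxx ltnn (ltnW (ltnW kb)) => /(_ isT).
(* By [kb], the index k+2 is still in the range searched. The rise of [E] into k+1 gives b'_(k+1) <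
   a_(k+1); no rise after it gives a_(k+2) <= b'_(k+2). *)
have := leE _ kb; move: ltE; rewrite /E.
have := leb k; have := leb k.+1; have := leb k.+2; rewrite !psumS => *.
have := @leq_conjugate b k.+1 k.+2 (leqnSn _) => *.
have lt_a : ext0 a k.+2 < ext0 a k.+1 by lia.
rewrite /corner_seq /corner lt_a /= andbT ltnNge.
by apply/negP => nk; move: lt_a; rewrite /ext0 (nth_default _ nk).
Qed.

(** * Biadjacency matrices with prescribed row and column sums *)

Lemma bigraphicP n m (a : n.-tuple nat) (b : m.-tuple nat) :
  bigraphic a b <-> exists M : 'I_n -> 'I_m -> bool,
    (forall i, \sum_j (M i j : nat) = tnth a i)
    /\ (forall j, \sum_i (M i j : nat) = tnth b j).
Proof.
have degE (V : finType) (e : rel V) v : degree e v = \sum_w (e v w : nat).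
  by rewrite /degree -sum1dep_card big_mkcond; apply: eq_bigr => w _; case: (e v w).
have sumE (f : 'I_n + 'I_m -> nat) :
  \sum_w f w = \sum_i f (inl i) + \sum_j f (inr j) by rewrite big_sumType.
split=> [[e [[e_sym _ e_ll e_rr] da db]] | [M [Ma Mb]]].
  exists (fun i j => e (inl i) (inr j)); split=> [i|j].
    rewrite -da degE sumE [X in _ = X + _]big1 // => i' _.
    by rewrite (negbTE (e_ll _ _)).
  rewrite -db degE sumE [X in _ = _ + X]big1 ?addn0 => [|j' _].
    by apply: eq_bigr => i _; rewrite e_sym.
  by rewrite (negbTE (e_rr _ _)).
exists (fun v w => match v, w with
  | inl i, inr j | inr j, inl i => M i j | _, _ => false end).
split=> [|i|j]; first by split=> [[i|j] [i'|j']|[i|j]||].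
  by rewrite degE sumE [X in X + _]big1 ?Ma.
by rewrite degE sumE [X in _ + X]big1 ?addn0 ?Mb.
Qed.

Lemma eq_of_leq_sum (I : finType) (f g : I -> nat) :
  (forall i, f i <= g i) -> \sum_i f i = \sum_i g i -> f =1 g.
Proof.
move=> le_fg eq_sum i; apply/eqP.
move/eqP: eq_sum; rewrite (leqif_sum (fun i _ => leqif_eq (le_fg i))).
by move/forallP/(_ i).
Qed.

Lemma matrix_transfer n m (a : 'I_n -> nat) (M : 'I_n -> 'I_m -> bool) :
  (forall i j : 'I_n, i <= j -> a j <= a i) ->
  \sum_i a i = \sum_i \sum_j (M i j : nat) ->
  (forall k, \sum_(i < n | i < k) a i
     <= \sum_(i < n | i < k) \sum_j (M i j : nat)) ->
  exists M' : 'I_n -> 'I_m -> bool,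
    (forall i, \sum_j (M' i j : nat) = a i)
    /\ (forall j, \sum_i (M' i j : nat) = \sum_i (M i j : nat)).
Proof.
move=> a_noninc.
(* Induction on the total deficit: truncated subtraction counts only the rows whose sum is too
   small. *)
have [d] := ubnP (\sum_i (a i - \sum_j (M i j : nat))).
elim: d M => // d IH M; rewrite ltnS => le_d sum_a dom.
pose c i := \sum_j (M i j : nat).
have [/forallP le_ac|] := boolP [forall i, a i <= c i].
  by exists M; split=> // i; rewrite (eq_of_leq_sum _ _ _ le_ac sum_a).
rewrite negb_forall => /existsP[j0 Pj0].
case: (@arg_minnP _ j0 (fun i => ~~ (a i <= c i)) (@nat_of_ord n) Pj0) => j; rewrite -ltnNge => lt_cj minj {j0 Pj0}.
have le_ac (l : 'I_n) : l < j -> a l <= c l.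
  by move=> lj; rewrite leqNgt; apply/negP; rewrite ltnNge => /minj; rewrite leqNgt lj.
have splitj (f : 'I_n -> nat) :
    \sum_(l < n | l < j.+1) f l = f j + \sum_(l < n | l < j) f l.
  rewrite (bigD1 j) //=; congr (_ + _); apply: eq_bigl => l.
  by rewrite ltnS ltn_neqAle andbC.
(* Without a surplus before row [j], the deficit of row [j] would violate dominance at [j.+1]. *)
have [i /andP[ij lt_ai]] : exists i : 'I_n, (i < j) && (a i < c i).
  apply/existsP; apply: contraLR (dom j.+1) => /existsPn Nex.
  rewrite -ltnNge !splitj -addSn leq_add // leq_sum // => l lj.
  by have := Nex l; rewrite lj /= -leqNgt.
(* As c_i > a_i >= a_j > c_j, the ones of row [i] cannot all lie above ones of row [j]. *)
have [r Mir Mjr] : exists2 r, M i r & ~~ M j r.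
  have : ~~ [forall r, M i r ==> M j r].
    apply: contraL (leq_ltn_trans (a_noninc _ _ (ltnW ij)) lt_ai) => /forallP sub.
    rewrite -leqNgt ltnW // (leq_ltn_trans _ lt_cj) // leq_sum // => r _.
    by have := sub r; case: (M i r); case: (M j r).
  by rewrite negb_forall => /existsP[r]; rewrite negb_imply => /andP[]; exists r.
(* Only column [r] is permuted, so all column sums survive. *)
pose M' (l : 'I_n) s := M (if s == r then tperm i j l else l) s.
pose c' l := \sum_s (M' l s : nat).
have neq_ij : i != j by rewrite -val_eqE /= ltn_eqF.
have splitr (N : 'I_n -> 'I_m -> bool) l :
  \sum_s (N l s : nat) = N l r + \sum_(s | s != r) (N l s : nat) by rewrite (bigD1 r).
have c'E l : c' l = M (tperm i j l) r + \sum_(s | s != r) (M l s : nat).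
  rewrite /c' splitr /M' eqxx; congr (_ + _).
  by apply: eq_bigr => s /negbTE ->.
have c'i : (c' i).+1 = c i by rewrite c'E tpermL (negbTE Mjr) /c splitr Mir.
have c'j : c' j = (c j).+1 by rewrite c'E tpermR Mir /c splitr (negbTE Mjr).
have c'D l : l != i -> l != j -> c' l = c l.
  by move=> li lj; rewrite c'E tpermD 1?eq_sym // /c splitr.
have colM' s : \sum_l (M' l s : nat) = \sum_l (M l s : nat).
  rewrite /M'; case: (s == r) => //.
  by rewrite [RHS](reindex_inj (@perm_inj _ (tperm i j))).
have sum_c' : \sum_l c' l = \sum_l c l.
  by rewrite /c' /c exchange_big [RHS]exchange_big; apply: eq_bigr => s _; exact: colM'.
have [||k|M'' [rowM'' colM'']] := IH M'.
(* The deficit of row [j] drops by one; row [i] had a surplus and still has no deficit. *)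
- apply: leq_trans le_d; rewrite -/c -/c' (bigD1 j) //= [X in _ < X](bigD1 j) //=.
  rewrite -addSn -/(c' j) -/(c j) c'j leq_add //; first by lia.
  apply: leq_sum => l lj; rewrite -/(c' l) -/(c l).
  by have [->|li] := eqVneq l i; [lia | rewrite c'D].
- by rewrite sum_a -/c -/c' sum_c'.
(* Prefixes that stop before row [i] are unchanged, and those containing both rows keep their sum.
   In between, each row before [j] still has sum at least its target. *)
- rewrite -/c'.
  have [ki|ik] := leqP k i.
    rewrite [leqRHS](eq_bigr c) => [|l lk]; first exact: dom.
    by apply: c'D; rewrite -val_eqE /=; lia.
  have [kj|jk] := leqP k j.
    rewrite leq_sum // => l lk; rewrite -/(c' l).
    have [->|li] := eqVneq l i; first by lia.
    by rewrite c'D // ?le_ac // -?val_eqE /=; lia.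
  apply: leq_trans (dom k) _; rewrite -/c.
  rewrite (bigD1 j) // (bigD1 i) ?ik //= [leqRHS](bigD1 j) //.
  rewrite [X in _ <= _ + X](bigD1 i) ?ik //= -/(c i) -/(c j) -/(c' i) -/(c' j).
  rewrite -c'i c'j [leqRHS]addSnnS -addSn !leq_add2l.
  by rewrite leq_sum // => l /andP[/andP[_ lj] li]; rewrite -/(c' l) c'D.
by exists M''; split=> // s; rewrite colM'' colM'.
Qed.

Lemma bigraphic_of_dominated n m (a : n.-tuple nat) (b : m.-tuple nat) :
  sorted geq a -> \sum_(i < n) tnth a i = \sum_(i < m) tnth b i ->
  (forall k, GR a b k) -> bigraphic a b.
Proof.
move=> a_noninc sum_ab dom; apply/bigraphicP.
have GRE k : \sum_(i < n | i < k) tnth a i <= \sum_(j < m) minn (tnth b j) k.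
  by move: (dom k); rewrite /GR psum_ext0 psum_conjugate big_tuple.
(* Dominance at [n] forces every b_j <= n, so that the packed columns fit into the [n] rows. *)
have minb j : minn (tnth b j) n = tnth b j.
  move: j; apply: eq_of_leq_sum => [j|]; first exact: geq_minl.
  apply/eqP; rewrite eqn_leq leq_sum => [/=|j _]; last exact: geq_minl.
  rewrite -sum_ab (leq_trans _ (GRE n)) //.
  by rewrite [leqRHS](eq_bigl predT) // => i; rewrite ltn_ord.
pose M (i : 'I_n) (j : 'I_m) := i < tnth b j.
have topM k j : k <= n -> \sum_(i < n | i < k) (M i j : nat) = minn (tnth b j) k.
  move=> kn; rewrite -(big_ord_widen _ (fun i => i < tnth b j : nat) kn).
  rewrite -(big_mkord predT (fun i => i < tnth b j : nat)) /=.
  rewrite -(big_add1 _ _ 0 k.+1 predT (fun i => i <= tnth b j : nat)) sum_leq_nat.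
  lia.
have colM j : \sum_i (M i j : nat) = tnth b j.
  rewrite -minb -topM //; by apply: eq_bigl => i; rewrite ltn_ord.
have [i j ij||k|M' [rowM' colM']] := matrix_transfer _ _ (tnth a) M.
- rewrite !(tnth_nth 0); apply: (sorted_leq_nth _ _ 0 a_noninc) => //.
  + by move=> x y z /=; lia.
  + by move=> x /=.
  + by rewrite inE size_tuple.
  + by rewrite inE size_tuple.
- by rewrite sum_ab exchange_big; apply: eq_bigr => j _; rewrite colM.
(* Prefix sums over [n] rows are constant from [n] on. *)
- wlog kn : k / k <= n => [hw|].
    have [/hw //|nk] := leqP k n.
    rewrite (eq_bigl (fun i : 'I_n => i < n)) => [|i]; last first.
      by rewrite ltn_ord (ltn_trans (ltn_ord i)).
    apply: leq_trans (hw n (leqnn n)) _.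
    rewrite [leqRHS](eq_bigl (fun i : 'I_n => i < n)) // => i.
    by rewrite ltn_ord (ltn_trans (ltn_ord i)).
  rewrite exchange_big (eq_bigr _ (fun j _ => topM k j kn)).
  exact: GRE.
by exists M'; split=> // j; rewrite colM'.
Qed.

Lemma GR_of_bigraphic n m (a : n.-tuple nat) (b : m.-tuple nat) k :
  bigraphic a b -> GR a b k.
Proof.
move=> /bigraphicP[M [Ma Mb]]; rewrite /GR psum_ext0 psum_conjugate big_tuple.
rewrite -(eq_bigr _ (fun i _ => Ma i)) exchange_big leq_sum // => j _.
rewrite leq_min -Mb [leqRHS](bigID (fun i : 'I_n => i < k)) leq_addr /=.
have [kn|nk] := leqP k n.
  rewrite -[leqRHS]muln1 -[k in leqRHS]card_ord -sum_nat_const.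
  rewrite (big_ord_widen _ (fun=> 1) kn).
  by apply: leq_sum => i _; case: (M i j).
apply: (@leq_trans n); last exact: ltnW.
rewrite -[leqRHS]muln1 -[n in leqRHS]card_ord -sum_nat_const big_mkcond.
by apply: leq_sum => i _; case: ifP; case: (M i j).
Qed.

Theorem theorem3p4 (n m : nat) (a : n.-tuple nat) (b : m.-tuple nat)
  (a_noninc : sorted geq a)
  (sum_ab : \sum_(i < n) tnth a i = \sum_(i < m) tnth b i) :
  [<-> bigraphic a b;
       dominated (ext0 a) (conjugate b);
       forall k, 1 <= k <= n -> GR a b k;
       forall k, corner_seq a k -> k < maxterm b -> GR a b k;
       forall j, corner (conjugate a) j -> conjugate a j < maxterm b ->
         j * conjugate a j + conjugate_tail a j
           <= psum (conjugate b) (conjugate a j)].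
Proof.
tfae=> [ab k _ | dom k /andP[k0 _] | GRn k | GRc j cj kb | GRc'].
- exact: GR_of_bigraphic.
- exact: dom.
- by case/and3P=> kn k0 _ _; apply: GRn; rewrite k0 -(size_tuple a).
- have [j0 _] := andP cj.
  by rewrite psum_at_conjugate //; apply: GRc => //; exact: corner_conjugate_seq.
(* The cycle closes from (5) to (1) by way of (4): each corner [k] of [a] is c'_j for the corner j =
   a_k of the conjugate, with c = a. *)
- apply: bigraphic_of_dominated => //; apply: GR_of_corners => // k ck kb.
  have [cj kE] := corner_seq_conjugate _ _ a_noninc ck; have [j0 _] := andP cj.
  have := GRc' _ cj; rewrite psum_at_conjugate // kE; exact.
Qed.
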